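(* Uniformly for integers $2\le k\le n$, $\mathbb{E}[X_{\ge k}(n)]=O\big(n^{3/2}/(k-2)!\big)$. Consequently, for every $\varepsilon>0$, $$\mathbb{P}\Big(\mathcal{R}_n\le (1.5+\varepsilon)\frac{\log n}{\log\log n}\Big)=1-O\big(n^{-\varepsilon+o(1)}\big).$$
   Context: A plane increasing tree on $[n]$ is a rooted tree with vertex set $[n]$ in which every non-root vertex has a larger label than its parent (the root is $1$) and the children of each vertex are linearly ordered; there are $(2n-3)!!$ such trees. Let $T_n$ be chosen uniformly at random among them. The rank of a vertex $v$ is the number of edges of a shortest path from $v$ down to a leaf descendant of $v$. $X_{\ge k}(n)$ denotes the number of vertices of rank at least $k$ in $T_n$, and $\mathcal{R}_n$ the largest rank of a vertex of $T_n$. $\log$ is the natural logarithm. *)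

(* Defs.v *)
From HB Require Import structures.
From mathcomp Require Import all_boot all_order all_algebra.
From mathcomp Require Import all_classical all_reals all_analysis.

Set Implicit Arguments.
Unset Strict Implicit.
Unset Printing Implicit Defensive.

Import Order.TTheory GRing.Theory Num.Theory.

Local Open Scope nat_scope.

(* The vertex with label [l] of [1..n] is the ordinal [l - 1 : 'I_n], so the
   root is the ordinal of value 0.  A tree is given by [c], where [c v] is the
   list of the children of [v] from left to right.  Labels increase along the
   edges, the root is nobody's child, and every other vertex occurs exactly once
   among all the lists of children (i.e. it has a unique parent); since labels
   increase, following parents always ends at the root. *)
Definition is_plane_increasing n (c : {ffun 'I_n -> n.-bseq 'I_n}) : bool :=
  [forall v : 'I_n, all (fun w : 'I_n => v < w) (c v)] &&
  [forall w : 'I_n, \sum_(v < n) count_mem w (c v) == (val w != 0)].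

Definition pitree n := {c : {ffun 'I_n -> n.-bseq 'I_n} | is_plane_increasing c}.

Definition children n (t : pitree n) (v : 'I_n) : seq 'I_n := val t v.

Definition child n (t : pitree n) : rel 'I_n := fun v w => w \in children t v.

Definition leaf n (t : pitree n) (v : 'I_n) : bool := nilp (children t v).

(* [v :: p] is a downward path with [size p] edges ending at a leaf.  Such paths
   have fewer than [n] edges, and there is one from every vertex, so the default
   value [n] of the minimum is never attained. *)
Definition rank n (t : pitree n) (v : 'I_n) : nat :=
  \big[minn/n]_(p : n.-bseq 'I_n | path (child t) v p && leaf t (last v p))
    size p.

Definition X_ge k n (t : pitree n) : nat := #|[pred v | k <= rank t v]|.

Definition max_rank n (t : pitree n) : nat := \max_(v < n) rank t v.

Local Open Scope ring_scope.

Definition unif_expect (R : realType) (T : finType) (X : T -> R) : R :=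
  (\sum_(t : T) X t) / #|T|%:R.

Definition unif_prob (R : realType) (T : finType) (A : pred T) : R :=
  #|A|%:R / #|T|%:R.

(* Main.v *)
(** If [v] has rank at least [k], then following first children from [v] gives
    a chain [v < v_1 < ... < v_k].  Detaching the [v_i] from each other and
    making them the first [k] children of [v], in any of the [k!] orders, yields
    a new plane increasing tree from which the chain and the order can be read
    off.  Hence [k!] times the number of pairs (tree, vertex of rank at least
    [k]) is at most [n] times the number of trees, i.e. [E[X_{>=k}] <= n / k!].
    This beats the required bound, and with [k! >= (k / e)^k] and the first
    moment method the spare factor [sqrt n] absorbs all the lower order terms,
    so that the [o(1)] in the exponent can be taken to be 0. *)

Require Import Defs.
From HB Require Import structures.
From mathcomp Require Import all_boot all_order all_algebra.
From mathcomp Require Import all_classical all_reals all_analysis.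
From mathcomp Require Import perm ring lra.

Set Implicit Arguments.
Unset Strict Implicit.
Unset Printing Implicit Defensive.

Import Order.TTheory GRing.Theory Num.Theory.
Import numFieldNormedType.Exports.

Local Open Scope classical_set_scope.
Local Open Scope ring_scope.

(** * Trees as families of child lists *)

Section PlaneIncreasingTrees.
Local Open Scope nat_scope.
Variable n : nat.
Implicit Types (t : pitree n) (u v w : 'I_n).

(** The tree condition for plain functions, free of the length bound built into [n.-bseq], so that
    new trees can be described by list operations. *)
Definition is_pi (d : 'I_n -> seq 'I_n) : Prop :=
  (forall v w, w \in d v -> v < w) /\
  (forall w, \sum_(v < n) count_mem w (d v) = (val w != 0)).

Lemma children_is_pi t : is_pi (children t).
Proof.
case: t => c pc; have /andP[/forallP inc /forallP cnt] := pc.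
rewrite /children /=; split=> [v w|w].
  by move: (inc v) => /allP; apply.
by apply/eqP; exact: cnt.
Qed.

(** The length bound comes for free: each label occurs at most once overall, so every list is
    duplicate-free and has at most [n] entries. *)
Lemma pitree_exists (d : 'I_n -> seq 'I_n) : is_pi d ->
  exists t, children t =1 d.
Proof.
move=> [inc cnt].
have size_d v : size (d v) <= n.
  have uniq_d : uniq (d v).
    apply: count_mem_uniq => w; move: (cnt w); rewrite (bigD1 v) //=.
    rewrite -has_pred1 has_count.
    by case: (count_mem w (d v)) => [|[|m]] //; case: (val w != 0).
  by rewrite -[leqRHS]card_ord -(card_uniqP uniq_d) max_card.
have cE v : [ffun v => insub_bseq n (d v)] v = d v :> seq _.
  rewrite ffunE /insub_bseq /insubd /=; case: insubP => [x _ -> //|].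
  by rewrite size_d.
have pi : is_plane_increasing [ffun v => insub_bseq n (d v)].
  apply/andP; split.
    by apply/forallP => v; rewrite cE; apply/allP => w; exact: inc.
  by apply/forallP => w; under eq_bigr do rewrite cE; rewrite cnt.
by exists (Sub _ pi) => v; exact: cE.
Qed.

Lemma pitree_inj t1 t2 : children t1 =1 children t2 -> t1 = t2.
Proof. by move=> e; apply/val_inj/ffunP => v; exact/val_inj/e. Qed.

Lemma pitree_card_gt0 : 0 < #|{: pitree n}|.
Proof.
pose star (v : 'I_n) : seq 'I_n :=
  if v == 0 :> nat then [seq w : 'I_n <- enum 'I_n | w != 0 :> nat] else [::].
have [|t _] := @pitree_exists star; last by apply/card_gt0P; exists t.
rewrite /star; split=> [v w|w].
  by case: ifP => // /eqP ->; rewrite mem_filter lt0n => /andP[].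
have [w0|w0] /= := eqVneq (val w) 0.
  rewrite big1 // => v _; case: ifP => // _.
  by rewrite count_uniq_mem ?(filter_uniq _ (enum_uniq _)) // mem_filter w0.
have n0 : 0 < n by case: n w {w0} => [[] |].
rewrite (bigD1 (Ordinal n0)) //= big1 ?addn0 => [|v v0].
  rewrite count_uniq_mem ?(filter_uniq _ (enum_uniq _)) // mem_filter w0.
  by rewrite mem_enum.
by case: ifP => // /eqP e; case/eqP: v0; exact: val_inj.
Qed.

(** * Chains of first children *)

Definition first_child t v : 'I_n := head v (children t v).

(** [first_child] has the default [v] at a leaf; requiring the [k] starting points to be internal
    makes all [k] steps genuine edges. *)
Definition chain k t v : bool :=
  all (fun u => ~~ leaf t u) (traject (first_child t) v k).

Lemma first_child_eq t u : ~~ leaf t u ->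
  children t u = first_child t u :: behead (children t u).
Proof. by rewrite /leaf /first_child; case: (children t u). Qed.

Lemma first_child_gt t u : ~~ leaf t u -> u < first_child t u.
Proof.
move/first_child_eq => e; apply: (children_is_pi t).1.
by rewrite e mem_head.
Qed.

Lemma rank_le_size t v p : path (child t) v p -> leaf t (last v p) ->
  size p <= n -> rank t v <= size p.
Proof.
move=> pp lp sp; have := @bigmin_le_cond _ nat _ n (Bseq sp)
  (fun p : n.-bseq 'I_n => path (child t) v p && leaf t (last v p)) size.
by rewrite pp lp leEnat minEnat => /(_ isT).
Qed.

Lemma rank_le_n t v : rank t v <= n.
Proof. by rewrite /rank; elim/big_rec: _ => // p m _ le; rewrite geq_min le orbT. Qed.

(** A leaf met after [i < k] first-child steps would end a downward path with [i] edges, forcing the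
    rank below [k]. *)
Lemma rank_chain k t v : k <= rank t v -> chain k t v.
Proof.
move=> kr; apply/negPn/negP => /allPn[u]; rewrite negbK.
set f := first_child t.
have pathf i : (forall j, j < i -> ~~ leaf t (iter j f v)) ->
    path (child t) v (traject f (f v) i).
  elim: i v {kr} => //= i IH x nl; apply/andP; split.
    by rewrite /child (first_child_eq (nl 0 _)) // mem_head.
  by apply: IH => j ji; rewrite -iterSr; exact: nl.
move=> /trajectP ex lu.
have {ex lu}ex : exists i, (i < k) && leaf t (iter i f v).
  by case: ex lu => i ik -> lu; exists i; rewrite ik.
(* The first leaf is taken, so that every earlier vertex is internal and [pathf] applies. *)
case: (ex_minnP ex) => i /andP[ik li] imin.
have := @rank_le_size t v (traject f (f v) i).
rewrite size_traject last_traject li.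
have i_n : i <= n by rewrite (leq_trans (ltnW ik)) // (leq_trans kr) // rank_le_n.
rewrite pathf // => [/(_ isT isT i_n) ri|j ji].
  by have := leq_trans kr ri; rewrite leqNgt ik.
apply/negP => lj; have /imin : (j < k) && leaf t (iter j f v).
  by rewrite lj (ltn_trans ji).
by rewrite leqNgt ji.
Qed.

(** * Flattening a chain, and its injectivity *)

Section Flatten.
Variable k : nat.

Definition chain_tail t v : seq 'I_n := traject (first_child t) (first_child t v) k.

Definition permute_seq v (s : 'S_k) (p : seq 'I_n) : seq 'I_n :=
  [seq nth v p (s i) | i : 'I_k].

(* The chain [v, v_1, ..., v_k] of first children is cut into pieces, and
   [v_1, ..., v_k] become the first [k] children of [v], in the order given by
   [s].  Labels increase along the chain, so it can be recovered by sorting. *)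
Definition flatten_chain t v (s : 'S_k) u : seq 'I_n :=
  (if u == v then permute_seq v s (chain_tail t v) else [::]) ++
  (if u \in traject (first_child t) v k then behead (children t u)
   else children t u).

Lemma size_chain_tail t v : size (chain_tail t v) = k.
Proof. exact: size_traject. Qed.

Lemma size_permute_seq v s p : size (permute_seq v s p) = k.
Proof. by rewrite size_map -cardE card_ord. Qed.

Lemma chain_tailE t v :
  chain_tail t v = map (first_child t) (traject (first_child t) v k).
Proof. by rewrite /chain_tail; elim: k v => //= m IH v; rewrite IH. Qed.

Lemma traject_take_chain t v :
  traject (first_child t) v k = take k (v :: chain_tail t v).
Proof. by rewrite /chain_tail; elim: k v => //= m IH v; rewrite {1}IH. Qed.

Lemma perm_permute_seq v s p : size p = k -> perm_eq (permute_seq v s p) p.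
Proof.
move=> sp; have {2}-> : p = map (nth v p) (map val (enum 'I_k)).
  by rewrite val_enum_ord -sp map_nth_iota0 // take_size.
rewrite /permute_seq /image_mem -map_comp.
rewrite (map_comp (nth v p \o val) s); apply: perm_map.
apply: uniq_perm => [||i]; rewrite ?enum_uniq //.
  by rewrite map_inj_uniq ?enum_uniq //; exact: perm_inj.
by rewrite mem_enum -[i](permKV s) mem_map ?mem_enum //; exact: perm_inj.
Qed.

Lemma permute_seq_inj v (s1 s2 : 'S_k) p : uniq p -> size p = k ->
  permute_seq v s1 p = permute_seq v s2 p -> s1 = s2.
Proof.
move=> up sp /eq_in_map e; apply/permP => i; apply/val_inj/eqP.
by rewrite -(nth_uniq v _ _ up) ?sp ?ltn_ord //; apply/eqP/(e i); rewrite mem_enum.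
Qed.

Lemma chain_sorted t v : chain k t v ->
  path (fun a b : 'I_n => a < b) v (chain_tail t v).
Proof.
rewrite /chain_tail /chain; elim: k v => //= m IH v /andP[nl c].
by rewrite first_child_gt // IH.
Qed.

Lemma chain_tail_lt t v : chain k t v -> {in chain_tail t v, forall w, v < w}.
Proof.
move=> /chain_sorted; rewrite path_sortedE; last by move=> ? ? ?; exact: ltn_trans.
by move=> /andP[/allP].
Qed.

Lemma chain_tail_sorted t v : chain k t v ->
  sorted (fun a b : 'I_n => a < b) (chain_tail t v).
Proof. by move/chain_sorted/path_sorted. Qed.

Lemma chain_tail_uniq t v : chain k t v -> uniq (chain_tail t v).
Proof.
move/chain_tail_sorted; apply: sorted_uniq => [? ? ?|x]; first exact: ltn_trans.
exact: ltnn.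
Qed.

(** Chain vertices only move from their old parent to [v], which is smaller than all of them, so
    labels still increase and occurrence counts are unchanged. *)
Lemma flatten_chain_is_pi t v s : chain k t v -> is_pi (flatten_chain t v s).
Proof.
move=> ch; have [inc cnt] := children_is_pi t.
have pp := perm_permute_seq v s (size_chain_tail t v).
split=> [u w|w].
  rewrite mem_cat => /orP[|].
    by case: eqP => // ->; rewrite (perm_mem pp); exact: chain_tail_lt.
  by case: ifP => _ win; apply: inc => //; exact: mem_behead.
rewrite -cnt; under eq_bigr do rewrite count_cat.
rewrite big_split /= (bigD1 v) //= eqxx big1 ?addn0 => [|u /negbTE->//].
have /seq.permP -> := pp.
have ut : uniq (traject (first_child t) v k).
  rewrite traject_take_chain take_uniq //=.
  rewrite chain_tail_uniq // andbT; apply/negP => /(chain_tail_lt ch).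
  by rewrite ltnn.
(* Occurrences in the tail are counted by parent, matching the heads that [behead] removes from the
   lists of the chain vertices. *)
have -> : count_mem w (chain_tail t v) =
    \sum_(u < n) ((u \in traject (first_child t) v k) && (first_child t u == w)).
  rewrite chain_tailE count_map -sum1_count big_mkcond /= big_uniq //.
  by rewrite big_mkcond; apply: eq_bigr => u _ /=; case: (u \in _); case: eqP.
rewrite -big_split; apply: eq_bigr => u _ /=; case: ifP => uS //=.
by rewrite [in RHS](first_child_eq (allP ch u uS)).
Qed.

(** The first [k] children of [v] give the permuted tail; sorting it recovers the tail, then the
    permutation, and finally the heads that were removed. *)
Lemma flatten_chain_inj v t1 t2 (s1 s2 : 'S_k) : chain k t1 v -> chain k t2 v ->
  flatten_chain t1 v s1 =1 flatten_chain t2 v s2 -> t1 = t2 /\ s1 = s2.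
Proof.
move=> ch1 ch2 e.
have ep : permute_seq v s1 (chain_tail t1 v) = permute_seq v s2 (chain_tail t2 v).
  have := congr1 (take k) (e v); rewrite /flatten_chain eqxx.
  by rewrite !take_size_cat ?size_permute_seq.
have et : chain_tail t1 v = chain_tail t2 v.
  apply: (@irr_sorted_eq _ (fun a b : 'I_n => a < b)).
  - by move=> ? ? ?; exact: ltn_trans.
  - by move=> ?; exact: ltnn.
  - exact: chain_tail_sorted.
  - exact: chain_tail_sorted.
  move=> u; rewrite -(perm_mem (perm_permute_seq v s1 (size_chain_tail t1 v))).
  by rewrite ep; apply: perm_mem; apply: perm_permute_seq; exact: size_chain_tail.
have eS : traject (first_child t1) v k = traject (first_child t2) v k.
  by rewrite !traject_take_chain et.
split; last first.
  apply: (@permute_seq_inj v _ _ (chain_tail t1 v)); first exact: chain_tail_uniq.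
    exact: size_chain_tail.
  by rewrite ep et.
apply: pitree_inj => u; move: (e u); rewrite /flatten_chain ep => /eqP.
rewrite eqseq_cat // eqxx /= -eS => /eqP; case: ifP => // uS eb.
rewrite (first_child_eq (allP ch1 u uS)) (first_child_eq (u := u) (t := t2)).
  congr (_ :: _) => //.
  by move: et; rewrite !chain_tailE -eS => /eq_in_map; exact.
by apply: (allP ch2); rewrite -eS.
Qed.

End Flatten.

(** * Counting and first moment bounds *)

Lemma fact_card_chain k v :
  k`! * #|[pred t : pitree n | chain k t v]| <= #|{: pitree n}|.
Proof.
pose good : pred ('S_k * pitree n) := [pred x | chain k x.2 v].
(* On [good] the default [x.2] of [xget] is never returned, since the flattened lists do form a
   tree. *)
pose g (x : 'S_k * pitree n) : pitree n :=
  xget x.2 [set t | children t =1 flatten_chain x.2 v x.1]%classic.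
have gE x : good x -> children (g x) =1 flatten_chain x.2 v x.1.
  move=> gx; rewrite /g; case: xgetP => [y -> //|no].
  by have [t /no] := pitree_exists (flatten_chain_is_pi x.1 gx).
have <- : #|good| = k`! * #|[pred t : pitree n | chain k t v]|.
  by rewrite -card_Sn -cardX; apply: eq_card => -[s t]; rewrite !inE.
rewrite -(card_in_image (f := g)) ?max_card // => -[s1 t1] [s2 t2] g1 g2 eg.
have [] := @flatten_chain_inj k v t1 t2 s1 s2 g1 g2; last by move=> -> ->.
by move=> u; rewrite -(gE (s1, t1)) // -(gE (s2, t2)) // eg.
Qed.

Lemma fact_sum_X_ge k :
  k`! * \sum_(t : pitree n) X_ge k t <= n * #|{: pitree n}|.
Proof.
have -> : \sum_(t : pitree n) X_ge k t =
    \sum_(v < n) #|[pred t : pitree n | k <= rank t v]|.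
  under eq_bigr do rewrite /X_ge -sum1_card big_mkcond.
  rewrite exchange_big /=; apply: eq_bigr => v _.
  by rewrite -sum1_card [RHS]big_mkcond.
rewrite big_distrr /= -[X in X * _]card_ord -sum_nat_const.
apply: leq_sum => v _; apply: leq_trans (fact_card_chain k v).
rewrite leq_mul2l subset_leq_card ?orbT //.
by apply/fintype.subsetP => t; rewrite !inE; exact: rank_chain.
Qed.

(** Markov's inequality in counting form. The assumption [0 < k] excludes the empty maximum at
    [n = 0]. *)
Lemma card_max_rank_ge k : 0 < k ->
  #|[pred t : pitree n | k <= max_rank t]| <= \sum_(t : pitree n) X_ge k t.
Proof.
move=> k0; rewrite -sum1_card big_mkcond; apply: leq_sum => t _ /=.
case: ifP => //; rewrite inE => kmax.
rewrite /X_ge; case: (posnP #|_|) => // /card0_eq X0.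
move: kmax; rewrite leqNgt => /negP[]; rewrite -(prednK k0) ltnS.
apply/bigmax_leqP => v _; rewrite -ltnS (prednK k0) ltnNge.
by have := X0 v; rewrite !inE => ->.
Qed.

End PlaneIncreasingTrees.

Lemma expect_X_ge_le (R : realType) n k :
  unif_expect (fun t : pitree n => (X_ge k t)%:R) <= n%:R / k`!%:R :> R.
Proof.
rewrite /unif_expect -natr_sum ler_pdivrMr ?ltr0n ?pitree_card_gt0 //.
rewrite mulrAC ler_pdivlMr ?ltr0n ?fact_gt0 // -!natrM ler_nat mulnC.
exact: fact_sum_X_ge.
Qed.

Lemma prob_max_rank_gt_le (R : realType) n (x : R) : 0 <= x ->
  0 <= 1 - unif_prob R (fun t : pitree n => (max_rank t)%:R <= x)
    <= n%:R / (Num.truncn x).+1`!%:R.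
Proof.
move=> x0; set A := (fun t => _).
have N0 : (0 : R) < #|{: pitree n}|%:R by rewrite ltr0n pitree_card_gt0.
have -> : 1 - unif_prob R A = #|[predC A]|%:R / #|{: pitree n}|%:R.
  rewrite /unif_prob -[in RHS](addKn #|A| #|[predC A]|) cardC.
  by rewrite natrB ?max_card // mulrBl divff // gt_eqF.
rewrite divr_ge0 //=; set k := (Num.truncn x).+1.
apply: le_trans (expect_X_ge_le R n k).
rewrite /unif_expect -natr_sum ler_pM2r ?invr_gt0 // ler_nat.
apply: leq_trans _ (card_max_rank_ge _ _) => //.
apply/subset_leq_card/fintype.subsetP => t; rewrite !inE /A -ltNge.
by rewrite /k truncn_lt_nat.
Qed.

(** * Factorial and logarithm estimates *)

(** This is [(k / e)^k <= k!]: the term of index [k] in the series of [expR k] is at most the whole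
    sum. *)
Lemma expR_le_fact (R : realType) k : (0 < k)%N ->
  expR (k%:R * (ln k%:R - 1)) <= k`!%:R :> R.
Proof.
case: k => // k _; set K : R := k.+1%:R.
have K0 : 0 < K by rewrite ltr0n.
rewrite mulrBr mulr1 expRD expRN ler_pdivrMr ?expR_gt0 //.
rewrite expRM_natl lnK ?posrE // mulrC -ler_pdivrMr ?ltr0n ?fact_gt0 //.
by apply: le_trans (expR_ge1Dxn k (ltW K0)); rewrite lerDr.
Qed.

(** With [y = ln (ln n)], [x] is the rank threshold and [expR y = ln n]; the lower order terms cost
    at most [ln n / 2]. *)
Lemma mul_ln_growth (R : realType) (a y : R) :
  3 / 2 <= a -> 0 < y -> 4 * a * ln (4 * a) <= y ->
  let x := a * (expR y / y) in
  0 <= ln x - 1 /\ (a - 1 / 2) * expR y <= x * (ln x - 1).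
Proof.
move=> a1 y0 ya x; have a0 : 0 < a by lra.
have e0 := expR_gt0 y.
have lnx : ln x = ln a + y - ln y.
  by rewrite /x lnM ?ln_div ?posrE ?divr_gt0 ?expRK // addrA.
have lna : 0 <= ln a by rewrite ln_ge0; lra.
(* The tangent to [ln] at [4 * a]: with the threshold on [y] it yields [a * ln y <= y / 2 - a],
   where [- a] cancels the [- 1] in [ln x - 1]. *)
have lny : ln y <= y / (4 * a) - 1 + ln (4 * a).
  have -> : ln y = ln (y / (4 * a)) + ln (4 * a).
    by rewrite -lnM ?posrE ?divr_gt0 ?mulr_gt0 // divfK // gt_eqF // mulr_gt0.
  rewrite lerD2r -[X in ln X](subrKC 1) le_ln1Dx //.
  by rewrite ltrBrDl subrr divr_gt0 // mulr_gt0.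
have key : (a - 1 / 2) * y <= a * (ln x - 1).
  have : a * ln y <= a * (y / (4 * a) - 1 + ln (4 * a)) by rewrite ler_pM2l.
  have -> : a * (y / (4 * a) - 1 + ln (4 * a)) = y / 4 - a + (4 * a * ln (4 * a)) / 4.
    by field; rewrite gt_eqF.
  have := mulr_ge0 (ltW a0) lna.
  rewrite lnx !mulrBr mulrDr mulrBl; lra.
split.
  rewrite -(pmulr_rge0 _ a0); apply: le_trans key.
  by rewrite mulr_ge0 //; lra.
have -> : x * (ln x - 1) = a * (ln x - 1) * (expR y / y) by rewrite /x; ring.
have -> : (a - 1 / 2) * expR y = (a - 1 / 2) * y * (expR y / y).
  by field; rewrite gt_eqF.
by rewrite ler_pM2r // divr_gt0.
Qed.

Lemma div_fact_truncn_le (R : realType) (a y : R) :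
  3 / 2 <= a -> 0 < y -> 4 * a * ln (4 * a) <= y ->
  expR (expR y) / (Num.truncn (a * (expR y / y))).+1`!%:R
    <= expR ((3 / 2 - a) * expR y).
Proof.
move=> a1 y0 ya; have [] := mul_ln_growth a1 y0 ya.
set x := a * _; set k := (Num.truncn x).+1 => lnx1 xlnx.
have x0 : 0 < x by rewrite mulr_gt0 ?divr_gt0 ?expR_gt0 //; lra.
have xk : x < k%:R by exact: truncnS_gt.
rewrite ler_pdivrMr ?ltr0n ?fact_gt0 //.
apply: (@le_trans _ _ (expR ((3 / 2 - a) * expR y) * expR (k%:R * (ln k%:R - 1)))).
  rewrite -expRD ler_expR.
  (* Both factors grow from [x] to [k], and [ln x - 1] is nonnegative. *)
  suff : x * (ln x - 1) <= k%:R * (ln k%:R - 1) by move: xlnx; lra.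
  rewrite ler_pM ?(ltW x0) ?(ltW xk) // lerD2r ler_ln ?posrE ?ltr0n //.
  exact: ltW.
by rewrite ler_pM2l ?expR_gt0 // expR_le_fact.
Qed.

Theorem theorem3p3 (R : realType) :
  (exists C : R, forall n k : nat, (2 <= k <= n)%N ->
     unif_expect (fun t : pitree n => (X_ge k t)%:R)
       <= C * (n%:R `^ (3 / 2) / ((k - 2)`!)%:R)) /\
  (forall eps : R, 0 < eps ->
     exists2 delta : nat -> R, delta @ \oo --> (0 : R) &
       (fun n : nat => 1 - unif_prob R (fun t : pitree n =>
          (max_rank t)%:R <= (3 / 2 + eps) * (ln n%:R / ln (ln n%:R)) :> R))
       =O_\oo (fun n : nat => n%:R `^ (- eps + delta n))).
Proof.
split.
  (* [C = 1] works because [n <= n^(3/2)] and [(k - 2)! <= k!]. *)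
  exists 1 => n k /andP[k2 kn]; rewrite mul1r.
  apply: le_trans (expect_X_ge_le R n k) _.
  rewrite ler_pM // ?invr_ge0 //.
    rewrite -[leLHS]powRr1 // ler_powR //; last by lra.
    by rewrite ler1n (leq_trans _ kn) // (leq_trans _ k2).
  by rewrite lef_pV2 ?posrE ?ltr0n ?fact_gt0 // ler_nat leq_fact // leq_subr.
move=> eps eps0; exists (fun=> 0); first exact: cvg_cst.
set a := 3 / 2 + eps.
apply/eqO_exP; exists 1 => //.
(* Once [ln (ln n)] exceeds [m], it is positive and past the threshold of [mul_ln_growth]. *)
pose m : R := Num.max 1 (4 * a * ln (4 * a)).
near=> n.
have nm : expR (expR m) < n%:R by near: n; exact: nbhs_infty_gtr.
have n0 : (0 : R) < n%:R by apply: lt_trans nm; exact: expR_gt0.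
have Lm : expR m < ln n%:R by rewrite -[ltLHS]expRK ltr_ln ?posrE ?expR_gt0.
have L0 : 0 < ln (n%:R : R) by apply: lt_trans Lm; exact: expR_gt0.
have ym : m < ln (ln n%:R) by rewrite -[ltLHS]expRK ltr_ln ?posrE ?expR_gt0.
set y := ln (ln n%:R) in ym *.
have [y1 ya] : 1 <= y /\ 4 * a * ln (4 * a) <= y.
  by move: (ltW ym); rewrite /m ge_max => /andP[].
have y0 : 0 < y by lra.
have Ly : ln n%:R = expR y by rewrite /y lnK ?posrE.
have ny : n%:R = expR (expR y) by rewrite -Ly lnK ?posrE.
have x0 : 0 <= a * (ln n%:R / y).
  by rewrite mulr_ge0 ?divr_ge0 ?(ltW L0) ?(ltW y0) // /a; lra.
have /andP[p0 pn] := prob_max_rank_gt_le n x0.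
rewrite mul1r addr0 (ger0_norm p0) ger0_norm ?powR_ge0 //.
apply: (le_trans pn); rewrite /powR gt_eqF // Ly {1}ny.
have -> : - eps = 3 / 2 - a by rewrite /a; ring.
by apply: div_fact_truncn_le => //; rewrite /a; lra.
Unshelve. all: by end_near.
Qed.
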